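(* Let $\mathcal B=\{B_n\}_{n\in\mathbb N_1}$ be a Golomb system (with associated function $\gamma$) and $\kappa$ a Kirch function for $\mathcal B$. The space $(\mathbb Z,\mathcal T_{\mathcal B,\kappa})$ is Hausdorff if and only if for any two distinct $a,b\in\mathbb Z$ one can find a prime $p$ and an integer $r$ with $\gamma(p)\le r\le\kappa(p)$ such that $[a]_{p^r}$ and $[b]_{p^r}$ are two distinct points of $\mathbb Z/p^r\mathbb Z$, both lying outside $B_{p^r}$.
   Context: Notation: $\mathbb N=\{0,1,2,\dots\}$, $\mathbb N_1=\mathbb N-\{0\}$, $\mathcal P$ is the set of prime numbers, $v_p$ the $p$-adic valuation; $[a]_n$ is the class of $a$ in $\mathbb Z/n\mathbb Z$; for $n\mid m$, $\pi_n^m\colon\mathbb Z/m\mathbb Z\to\mathbb Z/n\mathbb Z$ is the natural projection. Golomb system: fix $\gamma\colon\mathcal P\to\mathbb N$ and, for each prime $p$, a nonempty subset $B_{p^{\gamma(p)}}\subseteq\mathbb Z/p^{\gamma(p)}\mathbb Z$, with $B_{p^{\gamma(p)}}\neq\mathbb Z/p^{\gamma(p)}\mathbb Z$ if $\gamma(p)>0$. Define $B_n\subseteq\mathbb Z/n\mathbb Z$ for all $n\in\mathbb N_1$ by: $B_1=\mathbb Z/1\mathbb Z$; $B_{p^r}=(\pi_{p^{\gamma(p)}}^{p^r})^{-1}(B_{p^{\gamma(p)}})$ if $r\ge\gamma(p)$; $B_{p^r}=\pi_{p^r}^{p^{\gamma(p)}}(B_{p^{\gamma(p)}})$ if $r<\gamma(p)$;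 and $B_n=\bigcap_{p\mid n}(\pi^n_{p^{v_p(n)}})^{-1}(B_{p^{v_p(n)}})$ in general. The family $\mathcal B=\{B_n\}_{n\in\mathbb N_1}$ is called a Golomb system. It is always assumed that $\gamma(p)$ is the smallest value giving rise to $\mathcal B$, i.e. the smallest $r$ such that $B_{p^s}=(\pi_{p^r}^{p^s})^{-1}(B_{p^r})$ for all $s\ge r$. A Kirch function for $\mathcal B$ is a map $\kappa\colon\mathcal P\to\mathbb N\cup\{\infty\}$ with $\gamma(p)\le\kappa(p)$ for every $p$; it is always assumed that $\kappa(p)=0$ if $\gamma(p)=0$. The topology $\mathcal T_{\mathcal B,\kappa}$ on $\mathbb Z$ has as subbase the cosets $a+p^r\mathbb Z$ with $a\in\mathbb Z$, $p\in\mathcal P$, $r\in\mathbb N$, $\gamma(p)\le r\le\kappa(p)$ and $[a]_{p^r}\notin B_{p^r}$. *)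

(* Defs.v *)
From HB Require Import structures.
From mathcomp Require Import all_boot all_order all_algebra.
From mathcomp Require Import all_classical topology.

Set Implicit Arguments.
Unset Strict Implicit.
Unset Printing Implicit Defensive.

Local Open Scope set_scope.
Local Open Scope nat_scope.

(* Z/nZ, for n > 0, with classes represented by their remainders. It is
   convertible to 'I_n for n of the form k.+1; unlike 'Z_n, it has exactly one
   element when n = 1. *)
Definition zmod (n : nat) : finType := 'I_n.-1.+1.

Definition zclass (n : nat) (a : int) : zmod n := inZp `|(a %% n%:Z)%Z|.

(* The natural projection from Z/mZ to Z/nZ, meaningful when n %| m. *)
Definition zproj (m n : nat) (x : zmod m) : zmod n := inZp (x : 'I_m.-1.+1).

(* B is a Golomb system with associated function gamma. Only the values of
   gamma at primes and of B at positive integers are relevant. *)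
Record golomb_system (gamma : nat -> nat) (B : forall n, {set zmod n}) : Prop :=
  GolombSystem {
  golomb_neq0 : forall p, prime p -> B (p ^ gamma p) != finset.set0;
  golomb_neqT : forall p, prime p -> 0 < gamma p ->
    B (p ^ gamma p) != finset.setTfor (zmod (p ^ gamma p));
  golomb_1 : B 1 = finset.setTfor (zmod 1);
  golomb_ge : forall p r, prime p -> gamma p <= r ->
    B (p ^ r) = @zproj (p ^ r) (p ^ gamma p) @^-1: B (p ^ gamma p);
  golomb_lt : forall p r, prime p -> r < gamma p ->
    B (p ^ r) = @zproj (p ^ gamma p) (p ^ r) @: B (p ^ gamma p);
  golomb_bigcap : forall n, 0 < n ->
    B n = \bigcap_(p <- primes n)
            (@zproj n (p ^ logn p n) @^-1: B (p ^ logn p n));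
  golomb_min : forall p r, prime p ->
    (forall s, r <= s ->
       B (p ^ s) = @zproj (p ^ s) (p ^ r) @^-1: B (p ^ r)) ->
    gamma p <= r
}.

(* Comparison of r with an element of N U {oo}, where None stands for oo. *)
Definition leq_oo (r : nat) (k : option nat) : bool :=
  if k is Some m then r <= m else true.

Record kirch_function (gamma : nat -> nat) (kappa : nat -> option nat) : Prop :=
  KirchFunction {
  kirch_ge : forall p, prime p -> leq_oo (gamma p) (kappa p);
  kirch_0 : forall p, prime p -> gamma p = 0 -> kappa p = Some 0
}.

Definition coset (a : int) (n : nat) : set int :=
  [set x : int | (n%:Z %| (x - a)%R)%Z]%classic.

Definition kirch_subbase (gamma : nat -> nat) (B : forall n, {set zmod n})
    (kappa : nat -> option nat) : set (set int) :=
  [set U : set int | exists (a : int) (p r : nat),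
     [/\ prime p, gamma p <= r, leq_oo r (kappa p),
         zclass (p ^ r) a \notin B (p ^ r) & U = coset a (p ^ r)]]%classic.

(* An alias of int, carrying the topology generated by kirch_subbase. *)
Definition kirch_space (gamma : nat -> nat) (B : forall n, {set zmod n})
  (kappa : nat -> option nat) : Type := int.

HB.instance Definition _ gamma B kappa :=
  Choice.on (@kirch_space gamma B kappa).

HB.instance Definition _ gamma B kappa :=
  @isSubBaseTopological.Build (@kirch_space gamma B kappa)
    (set int) (@kirch_subbase gamma B kappa) id.

(* Main.v *)
Require Import Defs.
From mathcomp Require Import all_boot all_order all_algebra.
From mathcomp Require Import all_classical topology.
From mathcomp Require Import finmap.

(** By the Chinese remainder theorem the cosets [a + mZ] and [b + nZ] are
    disjoint only if some prime power [p ^ r], [r] the smaller of the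
    valuations of [m] and [n] at [p], separates [a] from [b]. Each point [a]
    has a base of neighbourhoods [a + mZ] where every prime power exactly
    dividing [m] defines a subbasic coset of [a], and for [gamma p <= r] the
    condition [zclass (p ^ r) a \notin B (p ^ r)] does not depend on [r]; so
    such a [p ^ r] also satisfies the conditions of the criterion. *)

Import GRing.Theory.

Section Zclass.
Local Open Scope nat_scope.

Lemma zclass_val (n : nat) (a : int) : 0 < n ->
  Posz (zclass n a : 'I_n.-1.+1) = (a %% n%:Z)%Z.
Proof.
move=> n0; have nz : (n%:Z != 0)%R by rewrite eqz_nat -lt0n.
rewrite /zclass /= prednK // modn_small ?gez0_abs ?modz_ge0 //.
by rewrite -ltz_nat gez0_abs ?modz_ge0 // ltz_pmod.
Qed.

Lemma zclass_eq (n : nat) (a b : int) : 0 < n ->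
  zclass n a = zclass n b <-> (n%:Z %| (a - b)%R)%Z.
Proof.
move=> n0; rewrite -eqz_mod_dvd; split=> [ab|/eqP ab].
  by rewrite -!zclass_val // ab.
by apply/val_inj; apply: (can_inj absz_nat); rewrite !zclass_val.
Qed.

Lemma zproj_zclass (m n : nat) (a : int) : 0 < m -> n %| m ->
  @zproj m n (zclass m a) = zclass n a.
Proof.
move=> m0 nm; have n0 := dvdn_gt0 m0 nm.
apply/val_inj; apply: (can_inj absz_nat).
rewrite zclass_val //.
change (Posz (nat_of_ord (zclass m a : 'I_m.-1.+1) %% n.-1.+1) = (a %% n%:Z)%Z).
rewrite (prednK n0) -modz_nat zclass_val //; apply/eqP.
by rewrite eqz_mod_dvd (dvdz_trans (n := m)) // -eqz_mod_dvd modz_mod.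
Qed.

End Zclass.

Section Coset.
Local Open Scope nat_scope.

Lemma sub_coset (a b : int) (m n : nat) :
  n %| m -> coset b n a -> (coset a m `<=` coset b n)%classic.
Proof.
move=> nm ba x /= mx.
by rewrite /coset /= -(subrKA a) rpredD //; apply: dvdz_trans mx.
Qed.

(** The solvability half of the Chinese remainder theorem, for moduli that need not be coprime. *)
Lemma coset_meet (a b : int) (m n : nat) :
  ((gcdn m n)%N%:Z %| (a - b)%R)%Z -> (coset a m `&` coset b n !=set0)%classic.
Proof.
move=> /dvdzP[q abE]; have [u [v uvE]] := Bezoutz m n.
(* Since [a - b = q * gcd] and [u * m + v * n = gcd], this point is also [b + q * v * n]. *)
exists (a - q * u * m%:Z)%R; split; rewrite /coset /=.
  by rewrite addrAC subrr add0r rpredN dvdz_mull.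
rewrite addrAC abE -[(gcdn m n)%:Z%R]/(gcdz m n) -uvE mulrDr mulrA.
by rewrite addrAC subrr add0r mulrA dvdz_mull.
Qed.

Lemma disjoint_coset (a b : int) (m n : nat) : 0 < m -> 0 < n ->
  (coset a m `&` coset b n = set0)%classic ->
  exists p, [/\ p \in primes m, p \in primes n &
    ~~ ((p ^ minn (logn p m) (logn p n))%N%:Z %| (a - b)%R)%Z].
Proof.
move=> m0 n0 mn0; have g0 : 0 < gcdn m n by rewrite gcdn_gt0 m0.
have: ~~ (gcdn m n %| absz (a - b)%R).
  apply/negP => gab; have : (coset a m `&` coset b n !=set0)%classic.
    exact: coset_meet.
  by rewrite mn0 => -[].
(* Divisibility by the gcd can be tested on its primary parts, so one of them fails to divide
   [a - b]; its exponent is the smaller of the two valuations. *)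
move=> /(dvdn_partP _ g0)/existsNP[p /not_implyP[]].
rewrite -[p \in _]logn_gt0 logn_gcd // leq_min !logn_gt0 => /andP[pm pn] /negP.
by rewrite p_part logn_gcd // => ?; exists p.
Qed.

End Coset.

Section KirchSpace.
Local Open Scope nat_scope.
Context {gamma : nat -> nat} {B : forall n : nat, {set zmod n}}
  {kappa : nat -> option nat}.
Hypothesis hB : golomb_system gamma B.

(** From [gamma p] on, [B (p ^ r)] is a full preimage under the projection, which sends the class of
    [a] to the class of [a]. *)
Lemma zclass_notin_golomb (p r : nat) (a : int) : prime p -> gamma p <= r ->
  (zclass (p ^ r) a \notin B (p ^ r)) =
  (zclass (p ^ gamma p) a \notin B (p ^ gamma p)).
Proof.
move=> pp gr; rewrite (golomb_ge hB) // inE zproj_zclass ?dvdn_exp2l //.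
by rewrite expn_gt0 prime_gt0.
Qed.

Lemma leq_oo_trans (r s : nat) (k : option nat) :
  r <= s -> leq_oo s k -> leq_oo r k.
Proof. by case: k => //= k; apply: leq_trans. Qed.

(** The moduli whose cosets at [a] form the neighbourhood base. Avoidance of [B] is stated at level
    [gamma p], so that it does not change with the exponent of [p] in [m]. *)
Definition kirch_modulus (a : int) (m : nat) : Prop :=
  0 < m /\ forall p, p \in primes m ->
    [/\ gamma p <= logn p m, leq_oo (logn p m) (kappa p) &
        zclass (p ^ gamma p) a \notin B (p ^ gamma p)].

Lemma kirch_modulus_lcm (a : int) (m n : nat) :
  kirch_modulus a m -> kirch_modulus a n -> kirch_modulus a (lcmn m n).
Proof.
move=> [m0 Pm] [n0 Pn]; split=> [|p]; first by rewrite lcmn_gt0 m0.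
(* The valuation of the lcm is the larger of the two, so the conditions at [p] come from [m] or from
   [n]. *)
by rewrite -logn_gt0 logn_lcm //; case: (leqP (logn p m)) => _;
  rewrite logn_gt0; auto.
Qed.

Lemma kirch_modulus_prime_pow (a : int) (p r : nat) :
  prime p -> gamma p <= r -> leq_oo r (kappa p) ->
  zclass (p ^ r) a \notin B (p ^ r) -> kirch_modulus a (p ^ r).
Proof.
move=> pp gr rk; rewrite zclass_notin_golomb // => aB.
split=> [|q]; first by rewrite expn_gt0 prime_gt0.
case: r gr rk => [|r] gr rk; first by rewrite expn0.
by rewrite primesX // primes_prime // inE => /eqP->; rewrite pfactorK.
Qed.

Lemma open_kirch_modulus (U : set (kirch_space gamma B kappa)) (a : int) :
  open U -> U a -> exists2 m, kirch_modulus a m & (coset a m `<=` U)%classic.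
Proof.
move=> [D sD <-] [W DW Wa]; have [F sF WE] := sD _ DW.
(* [W] is the intersection of the finite family [F] of subbasic cosets; induction on [F] combines
   their moduli by lcm, starting from 1. *)
suff [m Pm mF] : exists2 m, kirch_modulus a m &
    forall V, V \in enum_fset F -> (coset a m `<=` V)%classic.
  exists m => // x mx; exists W => //; change (W x).
  by rewrite -WE => V /mF; apply.
have {}sF V : V \in enum_fset F -> kirch_subbase gamma B kappa V.
  by move=> /sF /set_mem.
have {}Wa V : V \in enum_fset F -> V a by move: (Wa : W a); rewrite -WE; apply.
elim: {D sD DW W WE} (enum_fset F) sF Wa => [_ _|V s IH sF Wa].
  by exists 1.
case: IH => [W sW|W sW|m Pm ms]; [|by apply: Wa; rewrite inE sW orbT|].
  by apply: sF; rewrite inE sW orbT.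
have Vs : V \in V :: s by rewrite inE eqxx.
have [b [p [r [pp gr rk bB VE]]]] := sF V Vs.
have ba := Wa V Vs; rewrite VE in ba.
have pr0 : 0 < p ^ r by rewrite expn_gt0 prime_gt0.
(* As [a] lies in the coset of [b], the centre can be moved to [a], whose class then also avoids
   [B (p ^ r)]. *)
have ab : zclass (p ^ r) a = zclass (p ^ r) b by apply/zclass_eq.
exists (lcmn m (p ^ r)).
  apply: kirch_modulus_lcm => //.
  by apply: kirch_modulus_prime_pow => //; rewrite ab.
move=> W; rewrite inE => /predU1P[->|/ms mW].
  by rewrite VE; apply: sub_coset; rewrite ?dvdn_lcmr.
apply: subset_trans mW; apply: sub_coset; rewrite ?dvdn_lcml //.
by rewrite /coset /= subrr.
Qed.

Lemma open_coset (a : int) (p r : nat) :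
  prime p -> gamma p <= r -> leq_oo r (kappa p) ->
  zclass (p ^ r) a \notin B (p ^ r) ->
  open (coset a (p ^ r) : set (kirch_space gamma B kappa)).
Proof.
move=> pp gr rk aB; exists [set coset a (p ^ r)]%classic.
  by move=> _ ->; apply: finI_from1; exists a, p, r.
by rewrite bigcup_set1.
Qed.

End KirchSpace.

Theorem proposition2p40 (gamma : nat -> nat) (B : forall n : nat, {set zmod n})
    (kappa : nat -> option nat)
    (hB : golomb_system gamma B) (hkappa : kirch_function gamma kappa) :
  hausdorff_space (kirch_space gamma B kappa) <->
  (forall a b : int, a <> b ->
     exists p r : nat,
       prime p /\ (gamma p <= r)%N /\ leq_oo r (kappa p) /\
       zclass (p ^ r) a <> zclass (p ^ r) b /\
       zclass (p ^ r) a \notin B (p ^ r)%N /\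
       zclass (p ^ r) b \notin B (p ^ r)%N).
Proof.
rewrite open_hausdorff; split=> [T2 a b /eqP ab|sep a b /eqP ab].
  have [[U V] /= [/set_mem Ua /set_mem Vb] [oU oV /eqP UV]] := T2 a b ab.
  have [m [m0 Pm] mU] := open_kirch_modulus hB _ _ oU Ua.
  have [n [n0 Pn] nV] := open_kirch_modulus hB _ _ oV Vb.
  have mn : (coset a m `&` coset b n = set0)%classic.
    by rewrite -subset0 -UV; apply: setISS.
  have [p [pm pn pab]] := disjoint_coset _ _ _ _ m0 n0 mn.
  have [gm km aB] := Pm p pm; have [gn kn bB] := Pn p pn.
  have pp : prime p by move: pm; rewrite mem_primes => /andP[].
  (* Both valuations are at least [gamma p], hence so is their minimum, and it inherits the upper
     bound [kappa p]. *)
  exists p, (minn (logn p m) (logn p n)).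
  have gmn : (gamma p <= minn (logn p m) (logn p n))%N by rewrite leq_min gm.
  do 2!split=> //; split; first exact: leq_oo_trans _ _ _ (geq_minl _ _) km.
  split; last by rewrite !(zclass_notin_golomb hB).
  by apply/zclass_eq; [rewrite expn_gt0 prime_gt0|exact/negP].
have [p [r [pp [gr [rk [/zclass_eq ne [aB bB]]]]]]] := sep a b ab.
have pr0 : (0 < p ^ r)%N by rewrite expn_gt0 prime_gt0.
(* Two cosets of the same modulus with distinct classes are disjoint. *)
exists (coset a (p ^ r), coset b (p ^ r)) => /=.
  by split; apply/mem_set; rewrite /coset /= subrr.
split; [exact: open_coset|exact: open_coset|].
apply/eqP; rewrite -subset0 => x [/= xa xb]; apply: ne => //.
by rewrite -(subrKA x) rpredD // -opprB rpredN.
Qed.
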